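(* Let $I\subset\mathbb{R}$ be a non-degenerate, closed, and bounded interval, let $f_n: I\to I$ be a $C^{2}$ map for each $n\geq 0$, and let $x_0\in I$. Assume that $\{f_n''\}_{n=0}^{\infty}$ is uniformly bounded in $I$. If $-\infty<\lambda(x_0)<0$ and $2\lambda(x_0)<\lambda_0(x_0)$, then the non-autonomous system $x_{n+1}=f_n(x_n)$, $n\geq 0$, is exponentially asymptotically stable at $x_0$.
   Context: Write $f_0^n:=f_{n-1}\circ\cdots\circ f_0$ for $n\ge 1$ and $f_0^0=\mathrm{id}$; the orbit of $x_0$ is $x_n=f_0^n(x_0)$, $n\ge 0$. Lyapunov exponent at $x_0$: $\lambda(x_0):=\limsup_{n\to\infty}\frac1n\sum_{k=0}^{n-1}\ln|f_k'(x_k)|$, and $\lambda_0(x_0):=\liminf_{n\to\infty}\frac1n\sum_{k=0}^{n-1}\ln|f_k'(x_k)|$, with values in the extended reals and the convention $\ln 0=-\infty$. Uniformly bounded in $I$: there is $M>0$ with $|f_n''(x)|\le M$ for all $x\in I$ and all $n\ge 0$. Exponential asymptotical stability at $x_0$: there exist positive constants $\delta$, $C$, and $\mu$ such that $|f_0^n(y_0)-f_0^n(x_0)|\le C\exp[-\mu n]$ for each $n\ge 0$ and any $y_0\in I$ with $|y_0-x_0|<\delta$. *)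

(* Defs.v *)
From mathcomp Require Export all_boot all_order all_algebra.
From mathcomp Require Export all_classical all_reals all_analysis.
Export Order.TTheory GRing.Theory Num.Theory.
Export numFieldNormedType.Exports.
Set Implicit Arguments.
Unset Strict Implicit.
Unset Printing Implicit Defensive.
Local Open Scope classical_set_scope.
Local Open Scope ring_scope.

(* Maps I -> I are total functions R -> R that send I into I. Derivatives are
   taken relative to I (hence one-sided at the endpoints of I), so that at points
   of I none of the notions below depends on the values outside I. *)

Definition diff_quotient (R : realType) (f : R -> R) (x y : R) : R :=
  (f y - f x) / (y - x).

Definition derivable_in (R : realType) (I : set R) (f : R -> R) (x : R) : Prop :=
  cvg (diff_quotient f x y @[y --> within I x^']).

Definition derive_in (R : realType) (I : set R) (f : R -> R) (x : R) : R :=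
  lim (diff_quotient f x y @[y --> within I x^']).

Definition C2_on (R : realType) (I : set R) (f : R -> R) : Prop :=
  [/\ forall x, I x -> derivable_in I f x,
      forall x, I x -> derivable_in I (derive_in I f) x &
      {within I, continuous (derive_in I (derive_in I f))}].

Fixpoint orbit0 (R : realType) (f : nat -> R -> R) (n : nat) (x : R) : R :=
  if n is m.+1 then f m (orbit0 f m x) else x.

(* [lne] is the extended logarithm, with [lne 0 = -oo]. The junk value at n = 0
   has no effect on the limits superior and inferior. *)
Definition lyapunov_mean (R : realType) (I : set R) (f : nat -> R -> R) (x0 : R)
    (n : nat) : \bar R :=
  ((n%:R^-1)%:E *
     \sum_(0 <= k < n) lne (`|derive_in I (f k) (orbit0 f k x0)|%:E))%E.

Definition lyapunov_sup (R : realType) (I : set R) (f : nat -> R -> R) (x0 : R)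
    : \bar R :=
  limn_esup (lyapunov_mean I f x0).

Definition lyapunov_inf (R : realType) (I : set R) (f : nat -> R -> R) (x0 : R)
    : \bar R :=
  limn_einf (lyapunov_mean I f x0).

Definition second_derivatives_bounded (R : realType) (I : set R)
    (f : nat -> R -> R) : Prop :=
  exists2 M : R, 0 < M &
    forall (n : nat) (x : R), I x -> `|derive_in I (derive_in I (f n)) x| <= M.

Definition exp_asymptotically_stable (R : realType) (I : set R)
    (f : nat -> R -> R) (x0 : R) : Prop :=
  exists delta C mu : R,
    [/\ 0 < delta, 0 < C, 0 < mu &
      forall (n : nat) (y0 : R), I y0 -> `|y0 - x0| < delta ->
        `|orbit0 f n y0 - orbit0 f n x0| <= C * expR (- mu * n%:R)].

(* Main.v *)
Require Import Defs.
From mathcomp Require Import ring lra.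
Local Open Scope classical_set_scope.
Local Open Scope ring_scope.

(** Let [d k] be the size of the derivative of [f k] along the orbit of [x0], let
    [P n] be the product of the [d k] for [k < n], and let [e n] be the distance
    at time [n] between the orbit of [x0] and that of a nearby point.  The
    bound [M] on the second derivatives gives
      [e n.+1 <= (d n + M * e n) * e n]
    ([C2_on_dist_le]).  To first order [e n] is [P n * e 0], and the relative
    error [r n := e n / P n] satisfies
      [r n.+1 <= r n + M * (P n ^+ 2 / P n.+1) * r n ^+ 2].
    If the weights [P n ^+ 2 / P n.+1] are dominated by a convergent geometric
    series, then for small [r 0] the corrections never add up to more than
    [r 0], so [e n <= 2 * e 0 * P n] for all [n] ([quadratic_recursion_le]).

    The Lyapunov exponents provide exactly this.  The hypotheses leave room for
    reals [al], [be] with [be < 0], [2 * be < al], and eventually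
      [expR (al * n) <= P n <= expR (be * n)]
    ([lyapunov_gap], [lyapunov_mean_ln]).  The weights are then at most a
    constant times [expR (2 * be - al) ^+ n], a geometric sequence of ratio less
    than 1: this is where [2 * lambda < lambda_0] is needed.  Finally
    [2 * e 0 * P n] decays at the rate [be]. *)

(** * Calculus with derivatives relative to a set *)

Lemma derivable_in_cvg {R : realType} {I : set R} {g : R -> R} {x : R} :
  derivable_in I g x ->
  forall e, 0 < e -> exists2 r, 0 < r &
    forall y, I y -> y != x -> `|y - x| < r ->
      `|derive_in I g x - diff_quotient g x y| < e.
Proof.
move=> /cvgrPdist_lt cvgq e e0.
have := cvgq _ e0; rewrite !near_withinE => /nbhs_ballP[r /= r0 rP].
exists r => // y Iy yx xyr; apply: (rP y) => //.
by rewrite /ball/= distrC.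
Qed.

(** Near [x] the difference quotient is bounded by [`|g' x| + 1], so [g] is
    Lipschitz at [x]. *)
Lemma derivable_in_continuous {R : realType} {I : set R} {g : R -> R} :
  (forall x, I x -> derivable_in I g x) -> {within I, continuous g}.
Proof.
move=> dg; apply/subspace_continuousP => x Ix.
have [r r0 rP] := derivable_in_cvg (dg x Ix) 1 ltr01.
set l := derive_in I g x in rP.
apply/cvgrPdist_lt => e e0; rewrite near_withinE.
have L0 : 0 < `|l| + 1 by rewrite ltr_wpDl.
near=> y => Iy.
have [->|yx] := eqVneq y x; first by rewrite subrr normr0.
have yx0 : y - x != 0 by rewrite subr_eq0.
have lq := rP y Iy yx.
have xyr : `|y - x| < r.
  by rewrite distrC; near: y; apply/nbhs_ballP; exists r.
have xye : `|y - x| < e / (`|l| + 1).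
  rewrite distrC; near: y; apply/nbhs_ballP; exists (e / (`|l| + 1)) => //=.
  by rewrite divr_gt0.
have -> : g x - g y = - (diff_quotient g x y * (y - x)).
  by rewrite /diff_quotient divfK// opprB.
rewrite normrN normrM.
have : `|diff_quotient g x y| < `|l| + 1.
  have := lq xyr; rewrite distrC => ql.
  have := ler_normD (diff_quotient g x y - l) l; rewrite subrK; lra.
move=> /ltW ql; apply: (le_lt_trans (ler_wpM2r (normr_ge0 _) ql)).
by rewrite mulrC -ltr_pdivlMr.
Unshelve. all: by end_near. Qed.

Lemma derivable_in_is_derive {R : realType} (I : set R) (g : R -> R) (x : R) :
  nbhs x I -> derivable_in I g x -> is_derive x 1 g (derive_in I g x).
Proof.
move=> nxI dg.
suff gl : h^-1 *: ((g \o shift x) (h *: 1) - g x) @[h --> 0^']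
     --> derive_in I g x.
  by apply: DeriveDef; [apply/cvg_ex; exists (derive_in I g x)|exact: cvg_lim].
apply/cvgrPdist_lt => e e0.
have [r r0 rP] := derivable_in_cvg dg e e0.
have /nbhs_ballP[s /= s0 sI] := nxI.
near=> h.
have h0 : h != 0 by near: h; exact: nbhs_dnbhs_neq.
have hs : `|h| < s by near: h; exact: dnbhs0_lt.
have hr : `|h| < r by near: h; exact: dnbhs0_lt.
have := rP (h + x); rewrite addrK -subr_eq0 addrK => /(_ _ h0 hr).
rewrite /diff_quotient addrK /= [h *: 1]mulr1 [_ / h]mulrC; apply.
by apply: sI; rewrite /ball/= opprD addrC subrK normrN.
Unshelve. all: by end_near. Qed.

(** The mean value theorem for relative derivatives, with the endpoints in
    either order.  The bound on [c - x] is the part of [c lies between x and y]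
    that survives the symmetrisation and the case [x = y]. *)
Lemma derive_in_mvt {R : realType} {a b : R} {g : R -> R} {x y : R} :
  (forall z, `[a, b]%classic z -> derivable_in `[a, b] g z) ->
  x \in `[a, b] -> y \in `[a, b] ->
  exists c, [/\ c \in `[a, b], `|c - x| <= `|y - x| &
    g y - g x = derive_in `[a, b] g c * (y - x)].
Proof.
move=> dg.
have cg := derivable_in_continuous dg.
have mvt u v : a <= u -> u < v -> v <= b ->
    exists2 c, u < c < v & g v - g u = derive_in `[a, b] g c * (v - u).
  move=> au uv vb.
  have [z||c] := @MVT R g (derive_in `[a, b] g) u v uv; last first.
  - by rewrite in_itv/=; exists c.
  - apply: continuous_subspaceW cg => z /=; rewrite !in_itv/=; lra.
  - rewrite in_itv/= => zuv; apply: derivable_in_is_derive.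
      have zab : z \in `]a, b[ by rewrite in_itv/=; lra.
      have := near_in_itvoo zab; apply: filterS => t; exact: subset_itv_oo_cc.
    by apply: dg; rewrite /= in_itv/=; lra.
rewrite !in_itv/= => xab yab.
have [xy|yx|<-] := ltgtP x y.
- have [|||c cxy ->] := mvt x y; [lra..|].
  exists c; rewrite in_itv/=; split=> //; first lra.
  by rewrite !gtr0_norm; lra.
- have [|||c cxy gE] := mvt y x; [lra..|].
  exists c; rewrite in_itv/=; split=> //; [lra| |].
    by rewrite !ltr0_norm; lra.
  by rewrite -opprB gE; ring.
- by exists x; rewrite in_itv/= !subrr normr0; split=> //; ring.
Qed.

(** A Taylor estimate obtained from two mean value theorems: the slope of the
    chord is [g' c] for some [c] within [`|y - x|] of [x], and [g' c] differs
    from [g' x] by at most [M * `|c - x|]. *)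
Lemma C2_on_dist_le {R : realType} {a b M : R} {g : R -> R} {x y : R} :
  C2_on `[a, b] g ->
  (forall z, `[a, b]%classic z ->
    `|derive_in `[a, b] (derive_in `[a, b] g) z| <= M) ->
  x \in `[a, b] -> y \in `[a, b] ->
  `|g y - g x| <= (`|derive_in `[a, b] g x| + M * `|y - x|) * `|y - x|.
Proof.
move=> [dg ddg _] Mg xab yab.
have [c [cab cxy ->]] := derive_in_mvt dg xab yab.
have [t [tab _ dcx]] := derive_in_mvt ddg xab cab.
rewrite normrM ler_wpM2r//.
rewrite -[X in `|X|](subrK (derive_in `[a, b] g x)) dcx addrC.
apply: le_trans (ler_normD _ _) _; rewrite lerD2l normrM.
by apply: ler_pM => //; exact: Mg.
Qed.

(** * The perturbed linear recursion *)

(** The finitely many exceptional indices are absorbed by the constant, to which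
    their ratios [`|u k| / v k] are added. *)
Lemma near_le_scale {R : realType} (K : R) (u v : nat -> R) :
  (forall n, 0 < v n) -> (\forall n \near \oo, u n <= K * v n) ->
  exists2 c, 0 < c & forall n, u n <= c * v n.
Proof.
move=> v0 [N _ NP].
have S0 m : 0 <= \sum_(k < m) `|u k| / v k.
  by apply: sumr_ge0 => k _; rewrite divr_ge0// ltW.
exists (`|K| + 1 + \sum_(k < N) `|u k| / v k) => [|n].
  by have := S0 N; have := normr_ge0 K; lra.
have [Nn|nN] := leqP N n.
  apply: le_trans (NP n Nn) _; rewrite ler_pM2r//.
  by have := S0 N; have := ler_norm K; lra.
rewrite -ler_pdivrMr// (bigD1 (Ordinal nN))//=.
have un : u n / v n <= `|u n| / v n by rewrite ler_pM2r ?invr_gt0// ler_norm.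
apply: le_trans un _; rewrite addrCA lerDl.
have : 0 <= \sum_(i < N | i != Ordinal nN) `|u i| / v i.
  by apply: sumr_ge0 => k _; rewrite divr_ge0// ltW.
by have := normr_ge0 K; lra.
Qed.

(** The relative error [e n / P n], where [P n] is the product of the [d k] for
    [k < n], grows at step [n] by at most [M * c * q ^+ n * (e n / P n) ^+ 2].
    As long as it stays below [2 * e 0], the smallness of [e 0] makes this
    increment at most [(1 - q) * q ^+ n * e 0].  The induction therefore carries
    the sharper bound [(2 - q ^+ n) * e 0], in which the geometric sum of the
    increments is already evaluated. *)
Lemma quadratic_recursion_le {R : realType} (d e : nat -> R) (M c q : R) :
  (forall n, 0 < d n) -> (forall n, 0 <= e n) ->
  (forall n, e n.+1 <= (d n + M * e n) * e n) ->
  0 <= M -> 0 <= q ->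
  (forall n, (\prod_(0 <= k < n) d k) ^+ 2
               <= c * q ^+ n * \prod_(0 <= k < n.+1) d k) ->
  4 * M * c * e 0 <= 1 - q ->
  forall n, e n <= 2 * e 0 * \prod_(0 <= k < n) d k.
Proof.
move=> d0 e0 eS M0 q0 Pc small n.
pose P n := \prod_(0 <= k < n) d k.
have P0 m : 0 < P m by exact: prodr_gt0.
have qn m : 0 <= q ^+ m by rewrite exprn_ge0.
have weaken m : (2 - q ^+ m) * e 0 * P m <= 2 * e 0 * P m.
  by rewrite ler_pM2r// ler_wpM2r// gerBl.
suff : e n <= (2 - q ^+ n) * e 0 * P n by move/le_trans; exact.
elim: n => [|n IH]; first by rewrite /P big_geq// expr0 mulr1; lra.
have PS : P n.+1 = P n * d n by rewrite /P big_nat_recr.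
have lin : d n * e n <= (2 - q ^+ n) * e 0 * P n.+1.
  by rewrite PS mulrA [_ * d n]mulrC ler_pM2l.
have quad : M * e n * e n <= (1 - q) * (q ^+ n * e 0 * P n.+1).
  have e2 : e n ^+ 2 <= (2 * e 0) ^+ 2 * (c * q ^+ n * P n.+1).
    apply: (@le_trans _ _ ((2 * e 0 * P n) ^+ 2)).
      apply: lerXn2r; rewrite ?nnegrE ?mulr_ge0 ?(ltW (P0 n))//.
      exact: le_trans IH (weaken n).
    by rewrite [leLHS]exprMn ler_wpM2l ?exprn_ge0 ?mulr_ge0//; exact: Pc.
  rewrite -mulrA -expr2; apply: le_trans (ler_wpM2l M0 e2) _.
  have -> : M * ((2 * e 0) ^+ 2 * (c * q ^+ n * P n.+1)) =
    4 * M * c * e 0 * (q ^+ n * e 0 * P n.+1) by ring.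
  by rewrite ler_wpM2r ?mulr_ge0 ?(ltW (P0 _))//.
apply: le_trans (eS n) _; rewrite mulrDl; apply: le_trans (lerD lin quad) _.
by rewrite exprS le_eqVlt; apply/orP; left; apply/eqP; ring.
Qed.

(** * From the Lyapunov exponents to exponential bounds *)

Lemma limn_esup_lt {R : realType} {u : nat -> \bar R} {x : \bar R} :
  (limn_esup u < x)%E -> \forall n \near \oo, (u n < x)%E.
Proof.
move=> /ereal_inf_lt[_ [A nA <-]] supx; near=> n.
apply: le_lt_trans supx; apply: ereal_sup_ubound; exists n => //.
by near: n.
Unshelve. all: by end_near. Qed.

Lemma limn_einf_gt {R : realType} {u : nat -> \bar R} {x : \bar R} :
  (x < limn_einf u)%E -> \forall n \near \oo, (x < u n)%E.
Proof.
rewrite /limn_einf lteNr => /limn_esup_lt.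
by apply: filterS => n; rewrite lteN2.
Qed.

Lemma lyapunov_mean_ln {R : realType} (I : set R) (f : nat -> R -> R) (x0 : R)
    (n : nat) :
  (forall k, derive_in I (f k) (orbit0 f k x0) != 0) ->
  lyapunov_mean I f x0 n =
  (n%:R^-1 * ln (\prod_(0 <= k < n) `|derive_in I (f k) (orbit0 f k x0)|))%:E.
Proof.
move=> d0; rewrite /lyapunov_mean.
suff -> : (\sum_(0 <= k < n) lne (`|derive_in I (f k) (orbit0 f k x0)|%:E) =
  (ln (\prod_(0 <= k < n) `|derive_in I (f k) (orbit0 f k x0)|))%:E)%E by [].
elim: n => [|n IH]; first by rewrite !big_geq// ln1.
rewrite !big_nat_recr//= IH leNgt normr_gt0 d0/= lnM ?posrE ?normr_gt0//.
by apply: prodr_gt0 => k _; rewrite normr_gt0.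
Qed.

(** One zero factor would make all later means equal to [-oo]. *)
Lemma lyapunov_inf_neq0 {R : realType} {I : set R} {f : nat -> R -> R} {x0 : R} :
  (-oo < lyapunov_inf I f x0)%E ->
  forall k, derive_in I (f k) (orbit0 f k x0) != 0.
Proof.
move=> infNy k; apply/eqP => dk0.
have [N _ /(_ (maxn N k.+1) (leq_maxl _ _))/=] := limn_einf_gt infNy.
rewrite /lyapunov_mean; set m := maxn N k.+1.
have km : (k < m)%N by rewrite leq_maxr.
suff -> : (\sum_(0 <= j < m) lne (`|derive_in I (f j) (orbit0 f j x0)|%:E)
   = -oo)%E.
  by rewrite gt0_muleNy ?ltxx// lte_fin invr_gt0 ltr0n (leq_ltn_trans _ km).
apply/esum_eqNyP; exists k; split => //; first by rewrite mem_index_iota.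
by rewrite dk0 normr0/= lexx.
Qed.

(** [al] is chosen first, strictly between [2 * s] and [l], and then [be]
    strictly between [s] and the smaller of [al / 2] and [0]. *)
Lemma lyapunov_gap {R : realType} {s l : \bar R} :
  (-oo < s -> s < 0 -> 2%:E * s < l -> exists al be : R,
    [/\ (be < 0)%R, (2 * be < al)%R, s < be%:E & al%:E < l])%E.
Proof.
case: s => [s| |]// _; rewrite lte_fin => s0.
have E (al : R) : 2 * s < al ->
    exists2 be, be < 0 /\ 2 * be < al & s < be.
  move=> sal; have [al0|al0] := leP al 0.
    by exists ((s + al / 2) / 2); [split|]; lra.
  by exists (s / 2); [split|]; lra.
case: l => [l| |]//.
  rewrite -EFinM lte_fin => sl.
  have [|be [be0 beal] sbe] := E ((2 * s + l) / 2); first lra.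
  by exists ((2 * s + l) / 2), be; rewrite !lte_fin; split=> //; lra.
move=> _; have [|be [be0 beal] sbe] := E 0; first lra.
by exists 0, be; rewrite lte_fin ltry.
Qed.

Theorem theorem4p1 (R : realType) (a b : R) (f : nat -> R -> R) (x0 : R)
  (hab : a < b)
  (hfI : forall (n : nat) (x : R), x \in `[a, b] -> f n x \in `[a, b])
  (hfC2 : forall n : nat, C2_on `[a, b] (f n))
  (hx0 : x0 \in `[a, b])
  (hbd : second_derivatives_bounded `[a, b] f)
  (hlamNy : (-oo < lyapunov_sup `[a, b] f x0)%E)
  (hlam0 : (lyapunov_sup `[a, b] f x0 < 0)%E)
  (hlam2 : (2%:E * lyapunov_sup `[a, b] f x0 < lyapunov_inf `[a, b] f x0)%E) :
  exp_asymptotically_stable `[a, b] f x0.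
Proof.
have [M M0 MP] := hbd.
have [al [be [be0 beal supbe alinf]]] := lyapunov_gap hlamNy hlam0 hlam2.
have dne0 := lyapunov_inf_neq0 (lt_trans (ltNyr al) alinf).
pose d k : R := `|derive_in `[a, b] (f k) (orbit0 f k x0)|.
have d0 k : 0 < d k by rewrite normr_gt0.
pose P n := \prod_(0 <= k < n) d k.
have P0 n : 0 < P n by exact: prodr_gt0.
have Pbe : \forall n \near \oo, P n <= expR be ^+ n.
  near=> n; have n0 : (0 < n)%N by near: n; exists 1%N.
  rewrite -expRM_natl -[P n]lnK ?posrE// ler_expR mulrC -ler_pdivrMr ?ltr0n//.
  rewrite mulrC -lee_fin /P -lyapunov_mean_ln//; apply: ltW.
  by near: n; exact: limn_esup_lt.
have Pal : \forall n \near \oo, expR al ^+ n <= P n.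
  near=> n; have n0 : (0 < n)%N by near: n; exists 1%N.
  rewrite -expRM_natl -[P n]lnK ?posrE// ler_expR mulrC -ler_pdivlMr ?ltr0n//.
  rewrite mulrC -lee_fin /P -lyapunov_mean_ln//; apply: ltW.
  by near: n; exact: limn_einf_gt.
pose q := expR (2 * be - al).
have q0 : 0 < q by exact: expR_gt0.
have q1 : q < 1 by rewrite expR_lt1; lra.
have [C C0 CP] : exists2 C, 0 < C & forall n, P n <= C * expR be ^+ n.
  apply: (@near_le_scale _ 1) => [n|]; first by rewrite exprn_gt0// expR_gt0.
  by apply: filterS Pbe => n; rewrite mul1r.
have [c c0 cP] : exists2 c, 0 < c & forall n, P n ^+ 2 / P n.+1 <= c * q ^+ n.
  (* [expR (- al)] makes up for the index [n.+1] in the lower bound of [P n.+1]. *)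
  apply: (@near_le_scale _ (expR (- al))) => [n|]; first by rewrite exprn_gt0.
  near=> n; rewrite ler_pdivrMr//.
  have Pn : P n <= expR be ^+ n by near: n.
  have Pn1 : expR al ^+ n.+1 <= P n.+1.
    near: n; have [N _ NP] := Pal; exists N => //= m Nm; exact/NP/leqW.
  apply: (@le_trans _ _ ((expR be ^+ n) ^+ 2)).
    by apply: lerXn2r => //; rewrite nnegrE ?exprn_ge0 ?expR_ge0 ?ltW.
  apply: (@le_trans _ _ (expR (- al) * q ^+ n * expR al ^+ n.+1)).
    rewrite -!expRM_natl -!expRD ler_expR -natr1; lra.
  by rewrite ler_wpM2l// mulr_ge0 ?exprn_ge0// ltW// expR_gt0.
have orbI n y : y \in `[a, b] -> orbit0 f n y \in `[a, b].
  by move=> yI; elim: n => //= n; exact: hfI.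
(* The radius makes the smallness condition of [quadratic_recursion_le] hold. *)
exists ((1 - q) / (4 * M * c)), (2 * ((1 - q) / (4 * M * c)) * C), (- be).
have K0 : 0 < 4 * M * c by rewrite !mulr_gt0.
have del0 : 0 < (1 - q) / (4 * M * c) by rewrite divr_gt0// subr_gt0.
split=> // [||n y0 y0I y0x0].
- by rewrite mulr_gt0// mulr_gt0.
- by rewrite oppr_gt0.
rewrite opprK [be * _]mulrC expRM_natl.
pose e n : R := `|orbit0 f n y0 - orbit0 f n x0|.
have eP : e n <= 2 * e 0 * P n.
  apply: (quadratic_recursion_le d e M c q) => // [m|m|||m|].
  - exact: normr_ge0.
  - exact: (C2_on_dist_le (hfC2 m) (MP m) (orbI m _ hx0) (orbI m _ y0I)).
  - exact: ltW.
  - exact: ltW.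
  - by rewrite -(ler_pdivrMr _ _ (P0 m.+1)); exact: cP.
  - by rewrite mulrC -ler_pdivlMr//; exact: ltW.
apply: le_trans eP _; rewrite -[X in _ <= X]mulrA.
apply: ler_pM => //; [|exact: ltW|].
  exact: mulr_ge0 (ler0n _ 2) (normr_ge0 _).
by rewrite ler_pM2l//; exact: ltW.
Unshelve. all: by end_near. Qed.
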